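(* Let $E$ be a Banach lattice and let $F$ be an order continuous Banach lattice. Then every $L$-weakly compact, $uaw$-continuous operator $T\colon E\to F$ is $uaw$-Dunford-Pettis.
   Context: A net $(x_\alpha)$ in a Banach lattice $G$ is $uaw$-convergent to $x$ if $|x_\alpha-x|\wedge u\to 0$ weakly for every $u\in G_+$. A bounded operator $T\colon E\to F$ between Banach lattices is $uaw$-continuous if it maps norm bounded $uaw$-null sequences in $E$ to $uaw$-null sequences in $F$; it is $uaw$-Dunford-Pettis if every norm bounded $uaw$-null sequence $(x_n)$ in $E$ satisfies $\|Tx_n\|\to 0$; it is $L$-weakly compact if every disjoint sequence contained in the solid hull of $T(B_E)$ is norm null. *)

(* Defs.v *)
From HB Require Import structures.
From mathcomp Require Import all_boot all_order all_algebra.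
From mathcomp Require Import all_classical all_reals all_analysis.
Set Implicit Arguments. Unset Strict Implicit. Unset Printing Implicit Defensive.
Import Order.TTheory GRing.Theory Num.Theory.
Import numFieldNormedType.Exports.
Local Open Scope classical_set_scope.
Local Open Scope ring_scope.

Record BanachLatticeOn (R : realType) (E : normedModType R) := {
  bl_le : E -> E -> Prop;
  bl_join : E -> E -> E;
  bl_le_refl : forall x, bl_le x x;
  bl_le_anti : forall x y, bl_le x y -> bl_le y x -> x = y;
  bl_le_trans : forall x y z, bl_le x y -> bl_le y z -> bl_le x z;
  bl_join_ubl : forall x y, bl_le x (bl_join x y);
  bl_join_ubr : forall x y, bl_le y (bl_join x y);
  bl_join_lub : forall x y z, bl_le x z -> bl_le y z -> bl_le (bl_join x y) z;
  bl_le_add : forall x y z, bl_le x y -> bl_le (x + z) (y + z);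
  bl_le_scale : forall (a : R) x y, 0 <= a -> bl_le x y -> bl_le (a *: x) (a *: y);
  bl_norm_mono : forall x y,
    bl_le (bl_join x (- x)) (bl_join y (- y)) -> `|x| <= `|y|
}.

Section BL.
Context (R : realType) (E : normedModType R) (L : BanachLatticeOn E).

Definition bl_meet (x y : E) : E := - bl_join L (- x) (- y).
Definition bl_abs (x : E) : E := bl_join L x (- x).

Definition weakly_null (x : nat -> E) : Prop :=
  forall f : {linear E -> R^o}, continuous f ->
    (fun n => f (x n)) @ \oo --> (0 : R^o).

Definition uaw_null (x : nat -> E) : Prop :=
  forall u : E, bl_le L 0 u -> weakly_null (fun n => bl_meet (bl_abs (x n)) u).

Definition norm_bounded (x : nat -> E) : Prop :=
  exists M : R, forall n, `|x n| <= M.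

Definition disjoint_seq (y : nat -> E) : Prop :=
  forall n m, n <> m -> bl_meet (bl_abs (y n)) (bl_abs (y m)) = 0.

Definition norm_null (x : nat -> E) : Prop :=
  (fun n => `|x n|) @ \oo --> (0 : R).

Definition solid_hull (A : set E) : set E :=
  [set y | exists2 x, A x & bl_le L (bl_abs y) (bl_abs x)].

Definition order_continuous : Prop :=
  forall (I : Type) (le : I -> I -> Prop) (x : I -> E),
    (forall i, le i i) ->
    (forall i j k, le i j -> le j k -> le i k) ->
    (forall i j, exists k, le i k /\ le j k) ->
    (forall i j, le i j -> bl_le L (x j) (x i)) ->
    (forall i, bl_le L 0 (x i)) ->
    (forall z, (forall i, bl_le L z (x i)) -> bl_le L z 0) ->
    forall eps : R, 0 < eps -> exists i0, forall i, le i0 i -> `|x i| < eps.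

End BL.

Section Ops.
Context (R : realType) (E F : normedModType R)
  (LE : BanachLatticeOn E) (LF : BanachLatticeOn F).

Definition uaw_continuous (T : E -> F) : Prop :=
  forall x : nat -> E, norm_bounded x -> uaw_null LE x -> uaw_null LF (T \o x).

Definition uaw_Dunford_Pettis (T : E -> F) : Prop :=
  forall x : nat -> E, norm_bounded x -> uaw_null LE x -> norm_null (T \o x).

Definition L_weakly_compact (T : E -> F) : Prop :=
  forall y : nat -> F, disjoint_seq LF y ->
    (forall n, solid_hull LF (T @` [set x | `|x| <= 1]) (y n)) ->
    norm_null y.
End Ops.

(* Main.v *)
(** Let [x] be bounded and uaw-null in [E], and let [z n = |T (x n)|].  For
    [u >= 0] the sequence [z n /\ u] lies in an order interval and is weakly
    null; order continuity upgrades this to norm convergence.  Hence, if [z]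
    were not norm null, one could pick terms [x k] of [z], bounded away from
    [0] and almost disjoint from multiples of the preceding ones, and the
    elements [pos (x k - 4^k sum_(i < k) x i - 2^-k X)], with
    [X >= 2^-i x i] for all [i], would be disjoint and norm-close to [x k].
    Up to scaling they lie in the solid hull of the image of the unit ball,
    contradicting L-weak compactness. *)
Require Import Defs.
From HB Require Import structures.
From mathcomp Require Import all_boot all_order all_algebra.
From mathcomp Require Import all_classical all_reals all_analysis.
From mathcomp Require Import lra.
Set Implicit Arguments.
Unset Strict Implicit.
Unset Printing Implicit Defensive.
Import Order.TTheory GRing.Theory Num.Theory.
Import numFieldNormedType.Exports.
Local Open Scope classical_set_scope.
Local Open Scope ring_scope.

(** * Hahn-Banach theorem for sublinear functionals, by minimality *)

Section HahnBanach.
Context (R : realType) (V : lmodType R).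

Definition sublinear (q : V -> R) : Prop :=
  (forall x y, q (x + y) <= q x + q y) /\
  (forall (a : R) x, 0 <= a -> q (a *: x) <= a * q x).

Lemma sublinear0 q : sublinear q -> q 0 = 0.
Proof.
move=> [qD qZ]; apply/le_anti/andP; split.
  by have := qZ 0 0 (lexx 0); rewrite scale0r mul0r.
by have := qD 0 0; rewrite addr0; lra.
Qed.

Lemma sublinearZ q a x : sublinear q -> 0 <= a -> q (a *: x) = a * q x.
Proof.
move=> sq; rewrite le_eqVlt => /predU1P[<-|a0].
  by rewrite scale0r mul0r sublinear0.
apply/le_anti/andP; split; first exact: sq.2 (ltW a0).
rewrite -ler_pdivlMl// -{1}[x](scalerK (lt0r_neq0 a0)).
by apply: sq.2; rewrite invr_ge0 ltW.
Qed.

Lemma sublinear_geN q x : sublinear q -> - q (- x) <= q x.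
Proof.
by move=> sq; have := sq.1 x (- x); rewrite subrr (sublinear0 sq); lra.
Qed.

(** The two infima bounding the value at [x + y] are approached through independent indices [i] and
    [j]. The common index [k] is the sum of the parameters in the case of shifts, and the smaller of
    the two functionals in the case of a chain. *)
Lemma sublinear_inf (I : Type) (D : set I) (g : I -> V -> R) :
  D !=set0 ->
  (forall x, has_lbound [set g i x | i in D]) ->
  (forall i j x y, D i -> D j ->
    exists2 k, D k & g k (x + y) <= g i x + g j y) ->
  (forall a i x, 0 <= a -> D i -> exists2 k, D k & g k (a *: x) <= a * g i x) ->
  sublinear (fun x => inf [set g i x | i in D]).
Proof.
move=> [i0 Di0] lb gD gZ.
have infge k x : D k -> inf [set g i x | i in D] <= g k x.
  by move=> Dk; apply: ge_inf => //; exists k.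
have geinf m x : (forall i, D i -> m <= g i x) -> m <= inf [set g i x | i in D].
  move=> H; apply: lb_le_inf; first by exists (g i0 x), i0.
  by move=> _ [i Di <-]; exact: H.
split=> [x y|a x].
  rewrite -lerBlDr; apply: (geinf) => i Di.
  rewrite lerBlDr -lerBlDl; apply: (geinf) => j Dj; rewrite lerBlDl.
  have [k Dk Hk] := gD i j x y Di Dj.
  exact: le_trans (infge _ _ Dk) Hk.
rewrite le_eqVlt => /predU1P[<-|a0].
  have [k Dk Hk] := gZ 0 i0 x (lexx _) Di0.
  by rewrite !mul0r in Hk *; apply: le_trans Hk; exact: infge.
rewrite -ler_pdivrMl//; apply: (geinf) => i Di; rewrite ler_pdivrMl//.
have [k Dk Hk] := gZ a i x (ltW a0) Di.
exact: le_trans (infge _ _ Dk) Hk.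
Qed.

(* The largest sublinear functional below [q] whose value at [- y] is
   [- q y]. *)
Definition sublinear_shift (q : V -> R) (y x : V) : R :=
  inf [set q (x + t *: y) - t * q y | t in [set t : R | 0 <= t]].


Lemma sublinear_shift_lb q y x : sublinear q ->
  has_lbound [set q (x + t *: y) - t * q y | t in [set t : R | 0 <= t]].
Proof.
move=> sq; exists (- q (- x)) => _ [t /= t0 <-].
have := sq.1 (x + t *: y) (- x); rewrite addrC addKr sublinearZ//; lra.
Qed.

Lemma sublinear_shift_le q y x t : sublinear q -> 0 <= t ->
  sublinear_shift q y x <= q (x + t *: y) - t * q y.
Proof. by move=> sq t0; apply: ge_inf; [exact: sublinear_shift_lb|exists t]. Qed.

Lemma sublinear_shift_le0 q y x : sublinear q -> sublinear_shift q y x <= q x.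
Proof.
move=> sq; apply: le_trans (sublinear_shift_le _ _ sq (lexx 0)) _.
by rewrite scale0r mul0r subr0 addr0.
Qed.

Lemma sublinear_shift_sublinear q y : sublinear q ->
  sublinear (sublinear_shift q y).
Proof.
move=> sq; apply: (@sublinear_inf _ _ (fun t x => q (x + t *: y) - t * q y)).
- by exists 0 => /=.
- by move=> x; exact: sublinear_shift_lb.
- move=> s t x z /= s0 t0; exists (s + t); first exact: addr_ge0.
  by have := sq.1 (x + s *: y) (z + t *: y); rewrite addrACA -scalerDl; lra.
- move=> a t x a0 /= t0; exists (a * t); first exact: mulr_ge0.
  by rewrite -scalerA -scalerDr sublinearZ// mulrBr mulrA.
Qed.

(** Zorn's lemma for the reversed pointwise order. A nonempty chain is bounded by its pointwise
    infimum, which is finite because every member is at least [- p (- x)] at [x]; the empty chain is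
    bounded by [p]. *)
Lemma minimal_sublinear (p : V -> R) : sublinear p ->
  exists q, [/\ sublinear q, (forall x, q x <= p x) &
    forall r, sublinear r -> (forall x, r x <= q x) -> r = q].
Proof.
move=> sp; pose S := {q : V -> R | sublinear q /\ forall x, q x <= p x}.
pose le (q r : S) := `[< forall x, sval r x <= sval q x >].
have [t|r s t /asboolP rs /asboolP st|s t /asboolP st /asboolP ts|A Atot|] :=
    @Zorn S le.
- by apply/asboolP.
- by apply/asboolP => x; exact: le_trans (st x) (rs x).
- case: s t st ts => [s ps] [t pt] /= st ts.
  have est : s = t by apply/funext => x; apply/le_anti/andP.
  by case: t / est pt st ts => pt _ _; congr exist; exact: Prop_irrelevance.
- have [[a0 Aa0]|A0] := pselect (exists a, A a); last first.
    have pS : sublinear p /\ forall x, p x <= p x by [].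
    by exists (exist _ p pS) => s As; exfalso; apply: A0; exists s.
  have lbA x : has_lbound [set sval a x | a in A].
    exists (- p (- x)) => _ [[a [sa ap]] Aa <-] /=.
    by apply: le_trans (sublinear_geN _ sa); rewrite lerN2.
  have infA : sublinear (fun x => inf [set sval a x | a in A]).
    apply: sublinear_inf => //; first by exists a0.
    + move=> a b x y Aa Ab.
      have [/asboolP ab|/asboolP ba] := Atot _ _ Aa Ab.
        exists b => //; apply: le_trans ((svalP b).1.1 x y) _.
        by rewrite lerD2r.
      exists a => //; apply: le_trans ((svalP a).1.1 x y) _.
      by rewrite lerD2l.
    + by move=> c a x c0 Aa; exists a => //; exact: (svalP a).1.2.
  have infp x : inf [set sval a x | a in A] <= p x.
    by apply: le_trans ((svalP a0).2 x); apply: ge_inf => //; exists a0.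
  exists (exist (fun q => sublinear q /\ forall x, q x <= p x) _
    (conj infA infp)) => a Aa; apply/asboolP => x /=.
  by apply: ge_inf => //; exists a.
move=> [q [sq qp]] qmax; exists q; split=> // r sr rq.
have rp x : r x <= p x by exact: le_trans (rq x) (qp x).
have /(congr1 sval) := 
  qmax (exist (fun q => sublinear q /\ forall x, q x <= p x) r (conj sr rp))
    (asboolT rq).
by [].
Qed.

(* A minimal sublinear functional is linear, because it equals all its
   shifts. *)
Lemma hahn_banach (p : V -> R) (v : V) : sublinear p ->
  exists f : {linear V -> R^o}, (forall x, f x <= p x) /\ f v = p v.
Proof.
(* Starting from the shift along [v] forces [q (- v) <= - p v], hence [q v = p v] once [q] is
   linear. *)
move=> sp; pose p' := sublinear_shift p v.
have sp' : sublinear p' by exact: sublinear_shift_sublinear.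
have p'p x : p' x <= p x.
  exact: sublinear_shift_le0.
have [q [sq qp' qmin]] := minimal_sublinear sp'.
have qD x y : q (x + y) = q x + q y.
  apply/le_anti/andP; split; first exact: sq.1.
  have shiftE : sublinear_shift q y = q.
    apply: qmin => [|z]; first exact: sublinear_shift_sublinear.
    exact: sublinear_shift_le0.
  have := sublinear_shift_le y x sq ler01.
  by rewrite shiftE scale1r mul1r; lra.
have qN x : q (- x) = - q x.
  by apply/eqP; rewrite -addr_eq0 -qD addNr sublinear0.
have q_linear : linear (q : V -> R^o).
  move=> a x y; rewrite qD; congr (_ + _).
  have [a0|a0] := leP 0 a; first exact: sublinearZ.
  rewrite -[a in LHS]opprK scaleNr qN sublinearZ ?oppr_ge0 1?ltW//.
  by rewrite mulNr opprK.
exists (HB.pack_for {linear V -> R^o} (q : V -> R^o)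
  (GRing.isLinear.Build _ _ _ _ _ q_linear)); split=> [x|] /=.
  exact: le_trans (qp' x) (p'p x).
apply/le_anti/andP; split; first exact: le_trans (qp' v) (p'p v).
have : q (- v) <= p (- v + 1 *: v) - 1 * p v.
  exact: le_trans (qp' _) (sublinear_shift_le _ _ sp ler01).
by rewrite scale1r mul1r addNr sublinear0// sub0r qN lerN2.
Qed.
End HahnBanach.

(** * Vector lattice arithmetic and closedness of the positive cone *)

Section VectorLattice.
Context (R : realType) (F : normedModType R) (L : BanachLatticeOn F).
Local Notation le := (bl_le L).
Local Notation join := (bl_join L).
Local Notation meet := (bl_meet L).
Local Notation abs := (bl_abs L).
Implicit Types x y z u : F.

Lemma bl_leD x y z t : le x y -> le z t -> le (x + z) (y + t).
Proof.
move=> xy zt; apply: bl_le_trans (bl_le_add _ xy) _.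
by rewrite ![y + _]addrC; exact: bl_le_add.
Qed.

Lemma bl_subr_ge0 x y : le 0 (y - x) <-> le x y.
Proof.
split=> [/(bl_le_add x)|/(bl_le_add (- x))]; last by rewrite subrr.
by rewrite add0r subrK.
Qed.

Lemma bl_leN x y : le x y -> le (- y) (- x).
Proof. by move=> /bl_subr_ge0 xy; apply/bl_subr_ge0; rewrite opprK addrC. Qed.

Lemma bl_scale_ge0 (a : R) x : 0 <= a -> le 0 x -> le 0 (a *: x).
Proof. by move=> a0 /(bl_le_scale a0); rewrite scaler0. Qed.

Lemma bl_le_scalel (a b : R) x : a <= b -> le 0 x -> le (a *: x) (b *: x).
Proof.
move=> ab x0; apply/bl_subr_ge0; rewrite -scalerBl.
by apply: bl_scale_ge0; rewrite ?subr_ge0.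
Qed.

Lemma bl_add_ge0 x y : le 0 x -> le 0 y -> le 0 (x + y).
Proof. by move=> x0 y0; rewrite -[0]addr0; exact: bl_leD. Qed.

Lemma bl_sum_ge0 (I : Type) (r : seq I) (P : pred I) (x : I -> F) :
  (forall i, P i -> le 0 (x i)) -> le 0 (\sum_(i <- r | P i) x i).
Proof.
move=> x0; elim/big_ind : _ => //; [exact: bl_le_refl|exact: bl_add_ge0].
Qed.

Lemma bl_ler_sum (r : seq nat) (x : nat -> F) i : i \in r ->
  (forall j, le 0 (x j)) -> le (x i) (\sum_(j <- r) x j).
Proof.
move=> ir x0; rewrite (big_rem i ir) /= -{1}[x i]addr0.
by apply: bl_leD; [exact: bl_le_refl|exact: bl_sum_ge0].
Qed.

Lemma bl_joinC x y : join x y = join y x.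
Proof.
by apply: (bl_le_anti (b := L)); apply: bl_join_lub;
  solve [exact: bl_join_ubr|exact: bl_join_ubl].
Qed.

Lemma bl_joinDr x y z : join (x + z) (y + z) = join x y + z.
Proof.
apply: (bl_le_anti (b := L)).
  by apply: bl_join_lub; apply: bl_le_add; [exact: bl_join_ubl|exact: bl_join_ubr].
rewrite -[X in le _ X](subrK z); apply: bl_le_add; apply: bl_join_lub.
  by rewrite -{1}[x](addrK z); apply: bl_le_add; exact: bl_join_ubl.
by rewrite -{1}[y](addrK z); apply: bl_le_add; exact: bl_join_ubr.
Qed.

Definition bl_pos x := join x 0.
Local Notation pos := bl_pos.

Lemma bl_pos_ge0 x : le 0 (pos x). Proof. exact: bl_join_ubr. Qed.

Lemma bl_pos_ge x : le x (pos x). Proof. exact: bl_join_ubl. Qed.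

Lemma bl_pos_le x y : le 0 y -> le x y -> le (pos x) y.
Proof. by move=> y0 xy; exact: bl_join_lub. Qed.

Lemma bl_pos_mono x y : le x y -> le (pos x) (pos y).
Proof.
move=> xy; apply: bl_pos_le; first exact: bl_pos_ge0.
exact: bl_le_trans (bl_pos_ge y).
Qed.

Lemma bl_pos_id x : le 0 x -> pos x = x.
Proof.
move=> x0; apply: (bl_le_anti (b := L)); last exact: bl_pos_ge.
by apply: bl_pos_le => //; exact: bl_le_refl.
Qed.

Lemma bl_posB x : pos x - pos (- x) = x.
Proof.
have -> : pos (- x) = pos x - x.
  by rewrite /bl_pos -bl_joinDr subrr sub0r bl_joinC.
by rewrite opprB addrC subrK.
Qed.

Lemma bl_posD x y : le (pos (x + y)) (pos x + pos y).
Proof.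
apply: bl_pos_le; first by apply: bl_add_ge0; exact: bl_pos_ge0.
by apply: bl_leD; exact: bl_pos_ge.
Qed.

Lemma bl_posZ_le (a : R) x : 0 <= a -> le (pos (a *: x)) (a *: pos x).
Proof.
move=> a0; apply: bl_pos_le.
  by apply: bl_scale_ge0 => //; exact: bl_pos_ge0.
by apply: bl_le_scale => //; exact: bl_pos_ge.
Qed.

Lemma bl_abs_ge x : le x (abs x). Proof. exact: bl_join_ubl. Qed.

Lemma bl_abs_geN x : le (- x) (abs x). Proof. exact: bl_join_ubr. Qed.

Lemma bl_abs_ge0 x : le 0 (abs x).
Proof.
have : le 0 (abs x + abs x).
  by rewrite -(subrr x); apply: bl_leD; [exact: bl_abs_ge|exact: bl_abs_geN].
have h0 : (0 : R) <= 2^-1 by rewrite invr_ge0.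
move=> /(bl_scale_ge0 h0).
by rewrite -[abs x + _]mulr2n -[abs x *+ _]scaler_nat scalerK.
Qed.

Lemma bl_abs_id x : le 0 x -> abs x = x.
Proof.
move=> x0; apply: (bl_le_anti (b := L)); last exact: bl_abs_ge.
apply: bl_join_lub; first exact: bl_le_refl.
by apply: bl_le_trans (x0); rewrite -oppr0; exact: bl_leN.
Qed.

Lemma bl_norm_abs x : `|abs x| = `|x|.
Proof.
have aa : bl_join L (abs x) (- abs x) = bl_join L x (- x).
  exact/bl_abs_id/bl_abs_ge0.
by apply/le_anti/andP; split; apply: (bl_norm_mono (b := L));
  rewrite aa; exact: bl_le_refl.
Qed.

Lemma bl_norm_le x y : le 0 x -> le x y -> `|x| <= `|y|.
Proof.
move=> x0 xy; apply: (bl_norm_mono (b := L)).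
by rewrite -!/(bl_abs L _) !bl_abs_id//; exact: bl_le_trans xy.
Qed.

Lemma bl_norm_pos x : `|pos x| <= `|x|.
Proof.
rewrite -(bl_norm_abs x); apply: bl_norm_le; first exact: bl_pos_ge0.
by apply: bl_pos_le; [exact: bl_abs_ge0|exact: bl_abs_ge].
Qed.

Lemma bl_absZ (a : R) x : 0 <= a -> le (a *: abs x) (abs (a *: x)).
Proof.
rewrite le_eqVlt => /predU1P[<-|a0].
  by rewrite !scale0r; exact: bl_abs_ge0.
have ai0 : 0 <= a^-1 by rewrite invr_ge0 ltW.
rewrite -[X in le _ X](scalerKV (lt0r_neq0 a0)).
apply: bl_le_scale (ltW a0) _; apply: bl_join_lub.
  rewrite -{1}[x](scalerK (lt0r_neq0 a0)).
  by apply: bl_le_scale => //; exact: bl_abs_ge.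
rewrite -{1}[x](scalerK (lt0r_neq0 a0)) -scalerN.
by apply: bl_le_scale => //; exact: bl_abs_geN.
Qed.

(** Translation invariance of the join. Read as [x = pos (x - y) + meet x y], it splits [x] into its
    excess over [y] and its truncation by [y]. *)
Lemma bl_meetE x y : meet x y = x - pos (x - y).
Proof.
rewrite /bl_meet; apply/eqP; rewrite eqr_oppLR opprB /bl_pos -bl_joinDr.
by rewrite addrAC subrr !sub0r bl_joinC.
Qed.

Lemma bl_meet_lel x y : le (meet x y) x.
Proof. by rewrite -[X in le _ X]opprK; apply: bl_leN; exact: bl_join_ubl. Qed.

Lemma bl_meet_ler x y : le (meet x y) y.
Proof. by rewrite -[X in le _ X]opprK; apply: bl_leN; exact: bl_join_ubr. Qed.

Lemma bl_meet_glb x y z : le z x -> le z y -> le z (meet x y).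
Proof.
move=> zx zy; rewrite -[z]opprK; apply: bl_leN.
by apply: bl_join_lub; exact: bl_leN.
Qed.

Lemma bl_meet_ge0 x y : le 0 x -> le 0 y -> le 0 (meet x y).
Proof. exact: bl_meet_glb. Qed.

Lemma bl_meetS x y z t : le x z -> le y t -> le (meet x y) (meet z t).
Proof.
move=> xz yt; apply: bl_meet_glb.
  by apply: bl_le_trans xz; exact: bl_meet_lel.
by apply: bl_le_trans yt; exact: bl_meet_ler.
Qed.

(** After subtracting [z], the left side is below [x], because [z >= 0], and below [y]. *)
Lemma bl_meetD x y z : le 0 z -> le (meet x (y + z)) (meet x y + z).
Proof.
move=> z0; rewrite -[X in le X _](subrK z); apply: bl_le_add.
apply: bl_meet_glb; rewrite -[X in le _ X](addrK z); apply: bl_le_add.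
  apply: bl_le_trans (bl_meet_lel _ _) _; rewrite -{1}[x]addr0.
  by apply: bl_leD => //; exact: bl_le_refl.
exact: bl_meet_ler.
Qed.

Lemma bl_meet_posN x : meet (pos x) (pos (- x)) = 0.
Proof. by rewrite bl_meetE bl_posB subrr. Qed.

Lemma bl_meet0S x y z t : le 0 x -> le x z -> le 0 y -> le y t ->
  meet z t = 0 -> meet x y = 0.
Proof.
move=> x0 xz y0 yt zt; apply: (bl_le_anti (b := L)); last exact: bl_meet_ge0.
by rewrite -zt; exact: bl_meetS.
Qed.

(** For [y >= 0] one has [- x <= y - x], so [pos (- x)] lies below [abs (y - x)] and its norm is
    arbitrarily small. This is the norm closedness of the positive cone. *)
Lemma bl_ge0_approx x :
  (forall e : R, 0 < e -> exists2 y, le 0 y & `|y - x| < e) -> le 0 x.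
Proof.
move=> H; suff : pos (- x) = 0.
  by move=> px0; rewrite -(bl_posB x) px0 subr0; exact: bl_pos_ge0.
apply/eqP; rewrite -normr_le0; apply/ler_addgt0Pl => e e0; rewrite addr0.
have [y y0 /ltW yx] := H e e0; apply: le_trans yx.
rewrite -[X in _ <= X]bl_norm_abs; apply: bl_norm_le; first exact: bl_pos_ge0.
apply: bl_pos_le; first exact: bl_abs_ge0.
apply: bl_le_trans (bl_abs_ge _); rewrite -{1}[- x]add0r.
exact: bl_le_add.
Qed.

Lemma bl_lim_ge (s : nat -> F) x y : s @ \oo --> x ->
  (\forall n \near \oo, le y (s n)) -> le y x.
Proof.
move=> sx ys; apply/bl_subr_ge0; apply: bl_ge0_approx => e e0.
have /cvgrPdist_lt/(_ e e0) sxe := sx.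
near \oo => n; exists (s n - y); first by apply/bl_subr_ge0; near: n.
rewrite opprB addrA subrK distrC; near: n; exact: sxe.
Unshelve. all: by end_near. Qed.

Lemma bl_lim_le (s : nat -> F) x y : s @ \oo --> x ->
  (\forall n \near \oo, le (s n) y) -> le x y.
Proof.
move=> sx sy; rewrite -[x]opprK -[y]opprK; apply: bl_leN.
apply: (@bl_lim_ge (fun n => - s n)); first exact: cvgN.
by near=> n; apply: bl_leN; near: n.
Unshelve. all: by end_near. Qed.

(** The bounds [y / (k + 1)] of [x] tend to [0] in norm, and the order is closed under norm
    limits. *)
Lemma bl_archi x y : (forall k : nat, le (k%:R *: x) y) -> le x 0.
Proof.
move=> xy.
have H (k : nat) : le x (k.+1%:R^-1 *: y).
  have k0 : (0 : R) <= k.+1%:R^-1 by rewrite invr_ge0.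
  by have := bl_le_scale k0 (xy k.+1); rewrite scalerA mulVf// scale1r.
suff yk : (fun k : nat => k.+1%:R^-1 *: y) @ \oo --> (0 : F).
  exact: bl_lim_ge yk (nearW _ H).
rewrite -[X in _ --> X](scale0r y); apply: cvgZr_tmp.
exact: cvg_harmonic.
Qed.
End VectorLattice.

(** * Positive norming functionals and disjointification *)

Section NormedVectorLattice.
Context (R : realType) (F : normedModType R) (L : BanachLatticeOn F).
Local Notation le := (bl_le L).
Local Notation meet := (bl_meet L).
Local Notation pos := (bl_pos L).

Lemma monotone_le (s : nat -> F) : (forall n, le (s n) (s n.+1)) ->
  forall m n, (m <= n)%N -> le (s m) (s n).
Proof.
move=> sS m n /subnK <-; elim: (n - m)%N => [|k IH]; first exact: bl_le_refl.
by apply: bl_le_trans IH _; exact: sS.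
Qed.

(** Hahn-Banach for the sublinear functional [|pos x|], which vanishes on negative elements:
    domination by it gives monotonicity as well as the norm bound. For [v >= 0] the functional norms
    [v]. *)
Lemma positive_norming_functional (v : F) :
  exists f : {linear F -> R^o},
    [/\ continuous f, (forall x, f x <= `|x|),
     (forall x y, le x y -> f x <= f y) & f v = `|pos v|].
Proof.
have sp : sublinear (fun x => `|pos x|).
  split=> [x y|a x a0].
    apply: le_trans (ler_normD _ _); apply: (bl_norm_le (L := L)).
      exact: bl_pos_ge0.
    exact: bl_posD.
  rewrite -[a in leRHS]ger0_norm// -normrZ; apply: (bl_norm_le (L := L)).
    exact: bl_pos_ge0.
  exact: bl_posZ_le.
have [f [fp fv]] := hahn_banach v sp.
have fn x : f x <= `|x| by apply: le_trans (fp x) _; exact: bl_norm_pos.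
exists f; split=> // [|x y xy].
  apply: bounded_linear_continuous; apply/linear_boundedP.
  exists 1; split=> // r r1 x; apply: le_trans (ler_peMl _ (ltW r1)) => //.
  by rewrite ler_norml fn andbT lerNl -linearN -normrN fn.
rewrite -subr_le0 -linearB; apply: le_trans (fp _) _.
suff -> : pos (x - y) = 0 by rewrite normr0.
apply: (bl_le_anti (b := L)); last exact: bl_pos_ge0.
apply: bl_pos_le; first exact: bl_le_refl.
by rewrite -(subrr y); exact: bl_le_add.
Qed.

(* For [j < k] the positive parts [w j] and [w k] lie below multiples
   of the disjoint elements [pos (c *: x k - x j)] and [pos (x j - c *: x k)],
   where [c = 4^-k]. *)
Lemma disjointification (x : nat -> F) (X : F) :
  (forall n, le 0 (x n)) -> (forall n, le (2^-1 ^+ n *: x n) X) ->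
  disjoint_seq L (fun k =>
    pos (x k - (4 ^+ k *: (\sum_(i <- mkseq id k) x i) + 2^-1 ^+ k *: X))).
Proof.
move=> x0 xX; set w := fun k => _.
have X0 : le 0 X by apply: bl_le_trans (xX 0%N); exact: bl_scale_ge0.
have w0 k : le 0 (w k) by exact: bl_pos_ge0.
have wlt j k : (j < k)%N -> meet (w k) (w j) = 0.
  move=> jk; pose d := x k - 4 ^+ k *: x j.
  have k4 : (0 : R) <= 4^-1 ^+ k by rewrite exprn_ge0// invr_ge0.
  apply: (@bl_meet0S _ _ _ _ _ (pos d) (pos (- d))) => //; last exact: bl_meet_posN.
    apply: bl_pos_mono; apply: bl_leD; first exact: bl_le_refl.
    apply: bl_leN; rewrite -[X in le X _]addr0; apply: bl_leD.
      apply: bl_le_scale; first by rewrite exprn_ge0.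
      by apply: bl_ler_sum => //; apply/mapP; exists j; rewrite // mem_iota.
    by apply: bl_scale_ge0.
  have wj : le (w j) (4^-1 ^+ k *: pos (- d)).
    apply: bl_pos_le.
      by apply: bl_scale_ge0 => //; exact: bl_pos_ge0.
    apply: bl_le_trans (bl_le_scale k4 (bl_pos_ge L _)).
    rewrite opprB scalerBr scalerA -exprMn mulVf// expr1n scale1r.
    apply: bl_leD; first exact: bl_le_refl.
    apply: bl_leN; rewrite -[X in le X _]add0r; apply: bl_leD.
      apply: bl_scale_ge0; first by rewrite exprn_ge0.
      exact: bl_sum_ge0.
    (* The [X] term of [w j] absorbs [4^-k x k]: since [j < k], [4^-k <= 2^-j 2^-k], and
       [2^-k x k <= X]. *)
    apply: (@bl_le_trans _ _ _ _ (2^-1 ^+ j *: (2^-1 ^+ k *: x k))).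
      rewrite scalerA; apply: bl_le_scalel => //.
      have -> : (4^-1 : R) = 2^-1 * 2^-1 by rewrite -invfM -natrM.
      rewrite exprMn ler_wpM2r//; apply: ler_wiXn2l => //; last exact: ltnW.
      by rewrite invf_le1// ler1n.
    by apply: bl_le_scale.
  apply: bl_le_trans wj _; rewrite -[X in le _ X]scale1r.
  apply: bl_le_scalel; last exact: bl_pos_ge0.
  by apply: exprn_ile1; rewrite ?invr_ge0// invf_le1// ler1n.
move=> n m nm; rewrite !bl_abs_id//.
have [/wlt nmw|/wlt//|//] := ltngtP n m.
by rewrite /bl_meet bl_joinC.
Qed.

End NormedVectorLattice.

(** * Inductive selection of sequences, and elementary estimates *)

Lemma history_choice (T : Type) (Q : seq T -> T -> Prop) :
  (forall s, exists n, Q s n) ->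
  exists phi : nat -> T, forall k, Q (mkseq phi k) (phi k).
Proof.
move=> /choice [c cQ].
(* [hist k] is the list of the first [k] choices; each new choice may depend on all of it. *)
pose hist := fix hist k :=
  if k is k'.+1 then rcons (hist k') (c (hist k')) else [::].
pose phi k := c (hist k).
have histE k : hist k = mkseq phi k.
  by elim: k => // k IH; rewrite /= {1}IH mkseqS.
by exists phi => k; rewrite -histE; exact: cQ.
Qed.

Lemma not_norm_null (R : realType) (F : normedModType R) (x : nat -> F) :
  ~ norm_null x ->
  exists2 e : R, 0 < e & forall N, exists2 n, (N <= n)%N & e <= `|x n|.
Proof.
move=> nx; apply: contrapT => H; apply: nx.
apply/cvgrPdist_lt => e e0.
have [N HN] : exists N, forall n, (N <= n)%N -> `|x n| < e.
  apply: contrapT => H'; apply: H; exists e => // N.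
  apply: contrapT => H2; apply: H'; exists N => n Nn.
  by rewrite ltNge; apply/negP => ex; apply: H2; exists n.
exists N => // n /= Nn; rewrite sub0r normrN normr_id; exact: HN.
Qed.

(** Write [f t = f (t - s n) + f (s n)]; the first term is at most [|t - s n|]. *)
Lemma functional_lim_le (R : realType) (F : normedModType R)
    (f : {linear F -> R^o}) (s : nat -> F) (t : F) (c : R) :
  (forall x, f x <= `|x|) -> s @ \oo --> t ->
  (\forall n \near \oo, f (s n) <= c) -> f t <= c.
Proof.
move=> fn st fs; apply/ler_addgt0Pr => e e0.
have /cvgrPdist_lt/(_ e e0) ste := st.
near \oo => n; rewrite -[t](subrK (s n)) linearD addrC; apply: lerD.
  by near: n.
by apply: le_trans (fn _) _; apply/ltW; near: n; exact: ste.
Unshelve. all: by end_near. Qed.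

(** For [j < n] the sum equals [2 * 2^-j - 2 * 2^-n], by induction on the number of terms. *)
Lemma sum_half_powers_le (R : realType) (j n : nat) :
  \sum_(j <= l < n) (2^-1 : R) ^+ l <= 2 * 2^-1 ^+ j.
Proof.
have [nj|/ltnW/subnK <-] := leqP n j; first by rewrite big_geq// mulr_ge0.
suff -> : \sum_(j <= l < n - j + j) (2^-1 : R) ^+ l =
    2 * 2^-1 ^+ j - 2 * 2^-1 ^+ (n - j + j).
  by rewrite gerBl mulr_ge0.
elim: (n - j)%N => [|k IH]; first by rewrite add0n big_geq// subrr.
rewrite addSn big_nat_recr ?leq_addl//= IH exprS.
set a := 2^-1 ^+ _; set b := 2^-1 ^+ _; lra.
Qed.

(** * Consequences of order continuity and completeness *)

Section OrderContinuous.
Context (R : realType) (F : completeNormedModType R) (L : BanachLatticeOn F).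
Local Notation le := (bl_le L).
Local Notation meet := (bl_meet L).
Local Notation pos := (bl_pos L).

(* The net of all differences (upper bound of [s]) - (term of [s]) decreases
   to zero. *)
Lemma monotone_cvg (s : nat -> F) (u : F) : order_continuous L ->
  (forall n, le (s n) (s n.+1)) -> (forall n, le (s n) u) -> cvgn s.
Proof.
move=> oc sS su; have smono := monotone_le sS.
pose I := ({b : F | forall n, le (s n) b} * nat)%type.
have key (e : R) : 0 < e -> exists N, forall n, (N <= n)%N -> `|s n - s N| < e.
  move=> e0; pose leI (i j : I) := le (sval j.1) (sval i.1) /\ (i.2 <= j.2)%N.
  have [||||||[b N] HN] := oc I leI (fun i => sval i.1 - s i.2) _ _ _ _ _ _ e e0.
  - by move=> i; split=> //; exact: bl_le_refl.
  - move=> i j k [ij ij2] [jk jk2]; split; last exact: leq_trans jk2.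
    exact: bl_le_trans ij.
  - move=> [[b sb] m] [[c sc] n].
    have sbc k : le (s k) (meet b c) by apply: bl_meet_glb.
    exists (exist (fun b => forall n, le (s n) b) _ sbc, maxn m n).
    split; split; rewrite /= ?leq_maxl ?leq_maxr//.
      exact: bl_meet_lel.
    exact: bl_meet_ler.
  - move=> i j [ij ij2]; apply: bl_leD => //; apply: bl_leN; exact: smono.
  - by move=> [[b sb] n] /=; apply/bl_subr_ge0.
  (* If [z] is below all differences, subtracting [z] from an upper bound of [s] gives another upper
     bound. Iterating from [u] yields [k z <= u - s 0] for all [k], so [z <= 0] by the Archimedean
     property. *)
  - move=> z Hz; have H k n : le (s n) (u - k%:R *: z).
      elim: k n => [|k IH] n; first by rewrite scale0r subr0.
      have := Hz (exist (fun b => forall n, le (s n) b) _ IH, n) => /= /bl_subr_ge0.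
      move=> h; apply/bl_subr_ge0; move: h.
      by rewrite mulrS scalerDl scale1r addrC opprD addrA addrCA addrA addrAC.
    apply: (@bl_archi _ _ _ _ (u - s 0%N)) => k.
    apply/bl_subr_ge0; have /bl_subr_ge0 := H k 0%N.
    by rewrite addrAC.
  (* The bound [b] traps the tail: [0 <= s n - s N <= b - s N], and the last element has norm below
     [e]. *)
  exists N => n Nn.
  have := HN (b, N) (conj (bl_le_refl _ _) (leqnn _)) => /=.
  apply: le_lt_trans; apply: (bl_norm_le (L := L)).
    by apply/bl_subr_ge0; exact: smono.
  by apply: bl_le_add; exact: (svalP b).
apply/cauchy_cvgP/cauchy_exP => e e0; have [N HN] := key e e0.
exists (s N), N => // n /= Nn; rewrite -ball_normE /ball_ /= distrC; exact: HN.
Qed.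

(* Pick terms [w j] of [v] and norming functionals [g j] of [w j] such that
   [g i (w j) <= 2^-j] for [i < j].  The limits [t j >= w j] of the increasing
   sequences [u /\ (w j + ... + w n)] decrease to some [t] with [g i t <= 0],
   so that [`|w i| = g i (w i) <= g i (t i - t) <= `|t i - t|]. *)
Lemma weakly_null_interval_norm_null (v : nat -> F) (u : F) :
  order_continuous L -> (forall n, le 0 (v n)) -> (forall n, le (v n) u) ->
  weakly_null v -> norm_null v.
Proof.
move=> oc v0 vu vnull; apply: contrapT => /not_norm_null [e e0 He].
have [f Hf] := choice (fun n => positive_norming_functional L (v n)).
have [phi Hphi] : exists phi : nat -> nat, forall k, e <= `|v (phi k)| /\
    forall i, i \in mkseq phi k -> f i (v (phi k)) <= 2^-1 ^+ k.
  have [s|phi Hphi] := @history_choice nat (fun s n => e <= `|v n| /\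
      forall i, i \in s -> f i (v n) <= 2^-1 ^+ size s).
    (* Only finitely many functionals have been chosen so far, so weak nullity makes all of them
       small on [v n] eventually. *)
    have : \forall n \near \oo, forall i, i \in s -> f i (v n) <= 2^-1 ^+ size s.
      move: (size s) => k; elim: s => [|a s IH]; first exact: nearW.
      have k0 : (0 : R) < 2^-1 ^+ k by rewrite exprn_gt0.
      have [fc _ _ _] := Hf a.
      have /cvgrPdist_lt/(_ _ k0) fa := vnull (f a) fc.
      near=> n => i; rewrite in_cons => /predU1P[->|]; last first.
        by move: i; near: n; exact: IH.
      apply/ltW/(le_lt_trans (ler_norm _)); rewrite -normrN -sub0r.
      by near: n; exact: fa.
    move=> [N _ HN]; have [n Nn en] := He N.
    by exists n; split=> //; exact: HN.
  by exists phi => k; have := Hphi k; rewrite size_mkseq.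
pose w i := v (phi i); pose g i := f (phi i).
have gn i x : g i x <= `|x| by have [] := Hf (phi i).
have gmono i x y : le x y -> g i x <= g i y.
  by have [_ _ h _] := Hf (phi i); exact: h.
have ge i : e <= g i (w i).
  have [_ _ _ ->] := Hf (phi i); rewrite bl_pos_id; last exact: v0.
  by have [] := Hphi i.
have gw i j : (i < j)%N -> g i (w j) <= 2^-1 ^+ j.
  move=> ij; have [_] := Hphi j; apply.
  by apply/mapP; exists i; rewrite // mem_iota.
have u0 : le 0 u := bl_le_trans (v0 0%N) (vu 0%N).
(* Truncating by [u] keeps the increasing partial sums order bounded, hence norm convergent, while
   each [w l <= u] survives the truncation. *)
pose s j n := meet u (\sum_(j <= l < n) w l).
have sum0 j n : le 0 (\sum_(j <= l < n) w l) by apply: bl_sum_ge0 => l _; exact: v0.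
have sS j n : le (s j n) (s j n.+1).
  apply: bl_meetS; first exact: bl_le_refl.
  have [jn|nj] := leqP j n; last by rewrite big_geq// ltnW.
  rewrite big_nat_recr//= -{1}[\sum_(_ <= _ < _) _]addr0.
  by apply: bl_leD; [exact: bl_le_refl|exact: v0].
have s_cvg j : exists t : F, s j @ \oo --> t.
  exists (limn (s j)).
  by apply: (monotone_cvg oc (sS j)) => n; exact: bl_meet_lel.
have [t st] := choice s_cvg.
have s_le_t j n : le (s j n) (t j).
  by apply: bl_lim_ge (st j) _; exists n => // m /=; exact: monotone_le.
have w_le_t j : le (w j) (t j).
  apply: bl_le_trans (s_le_t j j.+1); rewrite /s big_nat1.
  by apply: bl_meet_glb; [exact: vu|exact: bl_le_refl].
have t_dec j : le (t j.+1) (t j).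
  apply: bl_lim_le (st j.+1) _; apply: nearW => n.
  apply: bl_le_trans (s_le_t j n); apply: bl_meetS; first exact: bl_le_refl.
  have [jn|nj] := ltnP j n; last by rewrite big_geq ?(leq_trans nj)//; exact: sum0.
  rewrite [X in le _ X]big_ltn// -{1}[\sum_(_ <= _ < _) _]add0r.
  by apply: bl_le_add; exact: v0.
have t0 j : le 0 (t j).
  by apply: bl_le_trans (s_le_t j 0%N); apply: bl_meet_ge0.
have tt' : cvgn (fun j => - t j).
  apply: (@monotone_cvg _ 0 oc) => [j|j]; first exact: bl_leN.
  by rewrite -oppr0; exact: bl_leN.
have {tt'} [t' tt'] : exists t' : F, t @ \oo --> t'.
  have -> : t = (fun j => - - t j) by apply/funext => j; rewrite opprK.
  by exists (- limn (fun j => - t j)); apply: cvgN.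
have t'_le j : le t' (t j).
  apply: bl_lim_le tt' _; exists j => // k /= jk.
  rewrite -[t k]opprK -[t j]opprK; apply: bl_leN.
  by apply: (@monotone_le _ _ L (fun j => - t j)) => // l; exact: bl_leN.
(* By monotonicity [g i (s j n)] is at most the sum of the [g i (w l)] with [l >= j > i], a
   geometric tail. *)
have gt j i : (i < j)%N -> g i (t j) <= 2 * 2^-1 ^+ j.
  move=> ij; apply: (functional_lim_le (gn i) (st j)); apply: nearW => n.
  apply: le_trans (gmono _ _ _ (bl_meet_ler _ _ _)) _.
  apply: le_trans (sum_half_powers_le R j n).
  rewrite linear_sum; apply: ler_sum_nat => l /andP[jl _].
  by apply: gw; exact: leq_trans jl.
have gt' i : g i t' <= 0.
  have h : (fun j => 2 * 2^-1 ^+ j : R) @ \oo --> (0 : R).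
    rewrite -[X in _ --> X](mulr0 2); apply: cvgMl_tmp.
    by apply: cvg_expr; rewrite ger0_norm// invf_lt1// ltr1n.
  apply/ler_addgt0Pr => d d0; rewrite add0r.
  have /cvgrPdist_lt/(_ d d0) hd := h.
  near \oo => j; apply: le_trans (gmono i _ _ (t'_le j)) _.
  have ij : (i < j)%N by near: j; exists i.+1.
  apply: le_trans (gt _ _ ij) _; apply/ltW/(le_lt_trans (ler_norm _)).
  by rewrite -normrN -sub0r; near: j; exact: hd.
have /cvgrPdist_lt/(_ e e0)[N _ HN] := tt'.
have := HN N (leqnn N); rewrite /= distrC ltNge => /negP; apply.
apply: le_trans (ge N) _; apply: le_trans (gmono _ _ _ (w_le_t N)) _.
apply: le_trans (gn N _); rewrite linearB lerBrDr.
by have := gt' N; lra.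
Unshelve. all: by end_near. Qed.

(** The series of the [2^-n x n] converges absolutely, and its sum dominates each of its positive
    terms. This supplies the [X] of the disjointification. *)
Lemma geometric_majorant (x : nat -> F) : (forall n, le 0 (x n)) ->
  norm_bounded x -> exists2 X, le 0 X & forall n, le (2^-1 ^+ n *: x n) X.
Proof.
move=> x0 [M xM]; pose s n := 2^-1 ^+ n *: x n.
have s0 n : le 0 (s n) by apply: bl_scale_ge0.
have cs : cvgn (series s).
  apply: normed_cvg.
  have c : cvgn (series (geometric M (2^-1 : R))).
    by apply: is_cvg_geometric_series; rewrite ger0_norm// invf_lt1// ltr1n.
  apply: series_le_cvg c => n; rewrite /geometric //=.
    by rewrite mulr_ge0//; exact: le_trans (xM 0%N).
  by rewrite /s normrZ ger0_norm// mulrC ler_wpM2r.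
have sX n : le (s n) (limn (series s) : F).
  apply: bl_lim_ge cs _; exists n.+1 => // m /= nm.
  by apply: bl_ler_sum => //; rewrite mem_index_iota.
by exists (limn (series s)) => //; exact: bl_le_trans (s0 0%N) (sX 0%N).
Qed.

(** A selection in the style of Kadec and Pelczynski: a term whose meet with a large multiple of its
    predecessors is small loses little norm when that multiple is subtracted and the positive part
    taken. *)
Lemma unbounded_null_disjoint (z : nat -> F) : (forall n, le 0 (z n)) ->
  norm_bounded z ->
  (forall u, le 0 u -> norm_null (fun n => meet (z n) u)) -> ~ norm_null z ->
  exists (phi : nat -> nat) (w : nat -> F),
    [/\ disjoint_seq L w, forall k, le 0 (w k), forall k, le (w k) (z (phi k)) &
     ~ norm_null w].
Proof.
move=> z0 [M zM] zu /not_norm_null[e e0 He].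
have [phi Hphi] : exists phi : nat -> nat, forall k, e <= `|z (phi k)| /\
    `|meet (z (phi k)) (4 ^+ k *: (\sum_(i <- mkseq id k) z (phi i)))|
      <= 2^-1 ^+ k.
  have [s|phi Hphi] := @history_choice nat (fun s n => e <= `|z n| /\
    `|meet (z n) (4 ^+ size s *: (\sum_(i <- s) z i))| <= 2^-1 ^+ size s).
    have u0 : le 0 (4 ^+ size s *: (\sum_(i <- s) z i)).
      by apply: bl_scale_ge0; [rewrite exprn_ge0|exact: bl_sum_ge0].
    have k0 : (0 : R) < 2^-1 ^+ size s by rewrite exprn_gt0.
    have /cvgrPdist_lt/(_ _ k0)[N _ HN] := zu _ u0.
    have [n Nn en] := He N; exists n; split=> //.
    by have /ltW := HN n Nn; rewrite /= sub0r normrN normr_id.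
  exists phi => k; have := Hphi k; rewrite size_mkseq.
  by rewrite /mkseq map_id big_map.
pose x i := z (phi i); have x0 i : le 0 (x i) by exact: z0.
have [|X X0 xX] := @geometric_majorant x x0; first by exists M => i; exact: zM.
pose a k := 4 ^+ k *: (\sum_(i <- mkseq id k) x i).
have a0 k : le 0 (a k).
  by apply: bl_scale_ge0; [rewrite exprn_ge0|exact: bl_sum_ge0].
pose w k := pos (x k - (a k + 2^-1 ^+ k *: X)).
exists phi, w; split.
- exact: disjointification.
- by move=> k; exact: bl_pos_ge0.
- move=> k; apply: bl_pos_le => //; rewrite -[X in le _ X]subr0.
  apply: bl_leD; first exact: bl_le_refl.
  by apply: bl_leN; apply: bl_add_ge0 => //; exact: bl_scale_ge0.
move=> wnull.
(* [x k] is [w k] plus its meet with [a k + 2^-k X]. That meet is at most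
   [meet (x k) (a k) + 2^-k X], where the first summand has norm at most [2^-k] by the choice of
   [phi k]. *)
have xw k : e <= `|w k| + 2^-1 ^+ k * (1 + `|X|).
  have [ez xk] := Hphi k; apply: le_trans ez _.
  have -> : z (phi k) = w k + meet (x k) (a k + 2^-1 ^+ k *: X).
    by rewrite bl_meetE addrCA subrr addr0.
  apply: le_trans (ler_normD _ _) _; rewrite lerD2l.
  have kX : le 0 (2^-1 ^+ k *: X) by exact: bl_scale_ge0.
  apply: (@le_trans _ _ `|meet (x k) (a k) + 2^-1 ^+ k *: X|).
    apply: (bl_norm_le (L := L)); last exact: bl_meetD.
    by apply: bl_meet_ge0 => //; exact: bl_add_ge0.
  apply: le_trans (ler_normD _ _) _; rewrite mulrDr mulr1; apply: lerD => //.
  by rewrite normrZ ger0_norm.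
have : (fun k => `|w k| + 2^-1 ^+ k * (1 + `|X|)) @ \oo --> (0 : R).
  rewrite -[X in _ --> X](addr0 0); apply: cvgD => //.
  rewrite -[X in _ --> X](mul0r (1 + `|X|)); apply: cvgMr_tmp.
  by apply: cvg_expr; rewrite ger0_norm// invf_lt1// ltr1n.
move=> /cvgrPdist_lt/(_ e e0)[N _ /(_ N (leqnn N))] /=.
rewrite sub0r normrN ltNge => /negP; apply.
exact: le_trans (xw N) (ler_norm _).
Qed.

End OrderContinuous.

(** * From uaw-null sequences to norm null images *)

Lemma uaw_null_unbounded_norm_null (R : realType) (F : completeNormedModType R)
    (L : BanachLatticeOn F) (y : nat -> F) (u : F) :
  order_continuous L -> uaw_null L y -> bl_le L 0 u ->
  norm_null (fun n => bl_meet L (bl_abs L (y n)) u).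
Proof.
move=> oc ynull u0; apply: (weakly_null_interval_norm_null oc) (ynull u u0) => n.
  by apply: bl_meet_ge0 => //; exact: bl_abs_ge0.
exact: bl_meet_ler.
Qed.

Unset Implicit Arguments.
Set Strict Implicit.

Theorem theorem2p19 (R : realType)
  (E : completeNormedModType R) (LE : BanachLatticeOn E)
  (F : completeNormedModType R) (LF : BanachLatticeOn F)
  (T : {linear E -> F}) (T_bounded : continuous T) :
  order_continuous LF ->
  L_weakly_compact LF T ->
  uaw_continuous LE LF T ->
  uaw_Dunford_Pettis LE T.
Proof.
move=> oc lwc uc x [M xM] xnull.
have Tnull : uaw_null LF (T \o x) by apply: uc => //; exists M.
(* [K >= M] brings [K^-1 *: x n] into the unit ball; [K >= 1] gives [K^-1 *: w k <= w k], so that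
   scaling preserves disjointness. *)
pose K := Num.max 1 M; have K1 : 1 <= K by rewrite le_max lexx.
have K0 : 0 < K by exact: lt_le_trans K1.
have Ki0 : 0 <= K^-1 by rewrite invr_ge0 ltW.
pose z n := bl_abs LF (T (x n)).
have Tbounded : norm_bounded z.
  have /linear_bounded_continuous/linear_boundedP HT := T_bounded.
  near +oo_R => r; exists (r * K) => n; rewrite bl_norm_abs.
  have Tr : forall y, `|T y| <= r * `|y| by near: r.
  apply: le_trans (Tr _) _; rewrite ler_wpM2l//.
  by apply: le_trans (xM _) _; rewrite le_max lexx orbT.
suff znull : norm_null z.
  by move: znull; rewrite /norm_null; under eq_fun do rewrite bl_norm_abs.
apply: contrapT => nz.
have [|u u0|//|phi [w [wd w0 wz wn]]] := @unbounded_null_disjoint _ _ LF z _ Tbounded.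
- by move=> n; exact: bl_abs_ge0.
- exact: uaw_null_unbounded_norm_null.
have v0 k : bl_le LF 0 (K^-1 *: w k) by exact: bl_scale_ge0.
have vnull : norm_null (fun k => K^-1 *: w k).
  apply: lwc => [n m nm|n].
    apply: bl_meet0S (wd n m nm); rewrite ?bl_abs_id//;
      rewrite -[X in bl_le _ _ X]scale1r; apply: bl_le_scalel => //;
      by rewrite invf_le1.
  (* Membership in the solid hull: [K^-1 w n <= K^-1 |T (x (phi n))| <= |T (K^-1 x (phi n))|]. *)
  exists (T (K^-1 *: x (phi n))).
    exists (K^-1 *: x (phi n)) => //=.
    rewrite normrZ ger0_norm// ler_pdivrMl// mulr1.
    by apply: le_trans (xM _) _; rewrite le_max lexx orbT.
  rewrite bl_abs_id// linearZ; apply: bl_le_trans (bl_absZ _ _ Ki0).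
  exact: bl_le_scale.
apply: wn; rewrite /norm_null in vnull *.
have -> : (fun n => `|w n|) = (fun n => K * `|K^-1 *: w n|).
  by apply/funext => n; rewrite normrZ ger0_norm// mulVKf// gt_eqF.
by rewrite -[X in _ --> X](mulr0 K); exact: cvgMl_tmp.
Unshelve. all: by end_near. Qed.
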